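(* Let $n\geq 3$ be an integer and let $\mathcal{X}$ be a $3$-dimensional polyhedral Banach space (that is, $\mathbb{R}^3$ with a polyhedral norm) whose closed unit ball $B_{\mathcal{X}}$ is the polyhedron with vertices $\left(\cos\frac{(j-1)\pi}{n},\ \sin\frac{(j-1)\pi}{n},\ \pm 1\right)$, $j\in\{1,2,\ldots,2n\}$, and $(0,0,\pm 2)$. Then $$\eta_{dw}(\mathcal{X})=\begin{cases}\sqrt{\sin^2\frac{\pi}{2n}+1}, & \text{when } n \text{ is odd},\\ \sqrt{\tan^2\frac{\pi}{2n}+1}, & \text{when } n \text{ is even}.\end{cases}$$
   Context: A finite-dimensional real Banach space is polyhedral if its closed unit ball has finitely many extreme points; the polyhedron with given vertices is their convex hull. $\mathcal{L}(\mathcal{X})$ is the space of bounded linear operators on $\mathcal{X}$ with the operator norm, and $S_{\mathcal{L}(\mathcal{X})}$ is its unit sphere; $\mathcal{X}^*$ is the dual; $S_{\mathcal{X}}=\{x:\|x\|=1\}$. For $x\in S_{\mathcal{X}}$ put $\mathcal{J}(x)=\{f\in\mathcal{X}^*: f(x)=1=\|f\|\}$, and $\Pi=\{(x,f): x\in S_{\mathcal{X}}, f\in\mathcal{J}(x)\}$. The Davis-Wielandt radius of $T$ is $dw(T)=\sup\left\{\sqrt{|x^*(Tx)|^2+\|Tx\|^4}:(x,x^* )\in\Pi\right\}$ and the Davis-Wielandt index of $\mathcal{X}$ is $\eta_{dw}(\mathcal{X})=\inf\{dw(T):T\in S_{\mathcal{L}(\mathcal{X})}\}$. *)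

(* Defs.v *)
From HB Require Import structures.
From mathcomp Require Import all_boot all_order all_algebra.
From mathcomp Require Import all_classical all_reals all_analysis.
Import Order.TTheory GRing.Theory Num.Theory.
Import numFieldNormedType.Exports.
Local Open Scope classical_set_scope.
Local Open Scope ring_scope.

Section DavisWielandt.
Context {R : realType}.

Definition closed_unit_ball (X : normedModType R) : set X :=
  [set x | `|x| <= 1].

Definition unit_sphere (X : normedModType R) : set X := [set x | `|x| = 1].

(* A linear map is bounded (on the unit ball) iff it is bounded near 0, see
   [linear_boundedP] *)
Definition bounded_operators (X Y : normedModType R) : 
    set {linear X -> Y} :=
  [set T : {linear X -> Y} | bounded_near T (nbhs (0 : X))].

Definition opnorm {X Y : normedModType R} (T : {linear X -> Y}) : R :=
  sup [set `|T x| | x in closed_unit_ball X].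

Definition operator_sphere (X : normedModType R) : set {linear X -> X} :=
  [set T : {linear X -> X} | bounded_operators X X T /\ opnorm T = 1].

Definition dual (X : normedModType R) : set {linear X -> R^o} :=
  bounded_operators X R^o.

Definition support_functionals {X : normedModType R} (x : X) :
    set {linear X -> R^o} :=
  [set f | [/\ dual X f, f x = 1 & opnorm f = 1]].

Definition state_pairs (X : normedModType R) : set (X * {linear X -> R^o}) :=
  [set p | unit_sphere X p.1 /\ support_functionals p.1 p.2].

Definition dw_radius {X : normedModType R} (T : {linear X -> X}) : R :=
  sup [set Num.sqrt (`|p.2 (T p.1)| ^+ 2 + `|T p.1| ^+ 4)
      | p in state_pairs X].

Definition dw_index (X : normedModType R) : R :=
  inf [set dw_radius T | T in operator_sphere X].

Definition convex_hull {E : lmodType R} (A : set E) : set E :=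
  smallest (fun C : set E => convex_set C) A.

Definition vec3 (x y z : R) : 'rV[R]_3 := \row_(k < 3) [:: x; y; z]`_k.

Definition capped_prism_vertices (n : nat) : set 'rV[R]_3 :=
  [set vec3 (cos ((j%:R - 1) * pi / n%:R)) (sin ((j%:R - 1) * pi / n%:R)) z
    | j in [set j : nat | (1 <= j <= 2 * n)%N] & z in [set 1; -1]]
  `|` [set vec3 0 0 2; vec3 0 0 (- 2)].

End DavisWielandt.

(* Main.v *)
Require Import Defs.
From HB Require Import structures.
From mathcomp Require Import all_boot all_order all_algebra.
From mathcomp Require Import all_classical all_reals all_analysis.
From mathcomp Require Import ring lra zify.
Import Order.TTheory GRing.Theory Num.Theory.
Import numFieldNormedType.Exports.
Local Open Scope classical_set_scope.
Local Open Scope ring_scope.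

(** Write d = pi / (2 n), let w_i = (cos (2 i d), sin (2 i d)) be the vertices
    of the regular 2n-gon and let e_i be w_i turned by a right angle.  The value
    to be found is sqrt (c^2 + 1), where c = k tan d with k = cos d for odd n
    and k = 1 for even n ([gap] and [shrink] below).  The number k is the
    largest h for which h e_i lies in the 2n-gon: a right angle is n times
    d, so e_i is a vertex for even n and the direction of an edge
    midpoint, at distance cos d, for odd n.

    Upper bound.  Let T (v, z) = (k R v, 0) with R the rotation by a right
    angle; T has norm 1.  At a vertex (w_i, 1), a small step along T runs
    almost along the edge from w_i to w_{i+1}: w_i + sin (2 d) e_i equals
    2 sin^2 d w_i + w_{i+1}, of norm at most 1 + 2 sin^2 d.  Hence
    |x + e T x| <= (1 + e c) |x| for e = sin (2 d) / k, first at vertices and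
    then, by convexity, everywhere; the same holds for - e.  If f supports the
    ball at x then f x = 1, so these two inequalities say exactly that
    |f (T x)| <= c, and dw(T)^2 <= c^2 + 1 ([dw_index_le],
    [quarter_operator_tilt]).  No list of the supporting functionals is needed
    here.

    Lower bound.  An operator of norm 1 attains its norm at a vertex v of the
    ball, so it is enough that for every y of norm 1 some f supporting the ball
    at v has |f y| >= c ([dw_index_ge]).  Let v = (w_i, 1) and
    y = a w_i + b e_i + z (0, 0, 1).  The four facets through v give the
    functionals a +- b tan d and (a + z +- b tan d) / 2.  When all four are
    smaller than c in absolute value, y splits into multiples of (w_i, -1),
    (0, 0, 2) and (k e_i, +- 1), all in the ball, with coefficients that add up
    to less than 1 ([frame_norm], [prism_gap]).  When v is the apex (0, 0, 2),
    take i with a maximal: the horizontal part of y then lies in the cone over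
    the two edges at w_i and has norm a + |b| tan d, so that a facet of one of
    the two caps does it, with |f y| >= 1 / 2 ([apex_gap]).  Both cases
    rest on c <= 1 / 2, and this is where n >= 3 enters. *)

(** * Normed spaces whose unit ball is the convex hull of a finite set *)

Lemma sub_convex_hull {R : realType} {E : lmodType R} (A : set E) :
  A `<=` convex_hull A.
Proof. by move=> v Av B [_]; exact. Qed.

(** The vectors that [L] sends into the ball of radius [m] form a convex set. *)
Lemma convex_hull_norm_le {R : realType} {E : lmodType R} {Y : normedModType R}
    (A : set E) (L : {linear E -> Y}) (m : R) :
  (forall v, A v -> `|L v| <= m) ->
  forall v, convex_hull A v -> `|L v| <= m.
Proof.
move=> Am v hv; apply: (hv [set v | `|L v| <= m]); split => //.
move=> x y l; rewrite !inE /= => xm ym.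
rewrite /conv /= linearD !linearZ /= (le_trans (ler_normD _ _))// !normrZ.
have l0 : 0 <= l%:num by [].
have l1 : l%:num <= 1 by [].
rewrite (ger0_norm l0) ger0_norm ?subr_ge0// /unstable.onem; nra.
Qed.

Lemma sup_ge0 {R : realType} (E : set R) :
  (forall x, E x -> 0 <= x) -> 0 <= sup E.
Proof.
move=> E0; have [supE|/sup_out -> //] := pselect (has_sup E).
have [[x Ex] ubE] := supE.
by rewrite (le_trans (E0 x Ex))//; exact: ub_le_sup.
Qed.

Section FiniteVertexSet.
Context {R : realType} {E : lmodType R} {X : normedModType R}.
Context {phi : {linear E -> X}} {A : set E}.
Hypothesis ballX : closed_unit_ball X = phi @` convex_hull A.

Lemma vertex_norm_le1 (a : E) : A a -> `|phi a| <= 1.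
Proof.
move=> Aa; suff : closed_unit_ball X (phi a) by [].
by rewrite ballX; exists a => //; exact: sub_convex_hull.
Qed.

(** The hull bound, made homogeneous: every estimate on operators and
    functionals below is checked at the vertices only. *)
Lemma norm_le_on_vertices {Y : normedModType R} (L : {linear X -> Y}) (m : R) :
  (forall a, A a -> `|L (phi a)| <= m) -> forall x, `|L x| <= m * `|x|.
Proof.
move=> Am x; have [->|x0] := eqVneq x 0; first by rewrite linear0 !normr0 mulr0.
have nx : 0 < `|x| by rewrite normr_gt0.
have : closed_unit_ball X (`|x|^-1 *: x).
  by rewrite /closed_unit_ball /= normrZ normfV normr_id mulVf ?gt_eqF.
rewrite ballX => -[v hv vx].
have := convex_hull_norm_le A (L \o phi) m Am v hv.
rewrite /= vx linearZ /= normrZ normfV normr_id.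
by rewrite ler_pdivrMl// mulrC.
Qed.

Hypotheses (finA : finite_set A) (A0 : A !=set0).

Lemma norm_attained_at_vertex {Y : normedModType R} (L : {linear X -> Y}) :
  exists2 a, A a & forall x, `|L x| <= `|L (phi a)| * `|x|.
Proof.
suff [a Aa amax] :
    exists2 a, A a & forall b, A b -> `|L (phi b)| <= `|L (phi a)|.
  by exists a => //; exact: norm_le_on_vertices.
have /finite_seqP[s As] := finA.
have : [set` s] !=set0 by rewrite -As.
rewrite As {As}; elim: s => [[//]|a s ih _].
have [s0|] := pselect ([set` s] !=set0); last first.
  move=> s0; exists a; first by rewrite /= mem_head.
  move=> b /=; rewrite inE => /orP[/eqP -> //|bs].
  by exfalso; apply: s0; exists b.
have [b bs bmax] := ih s0.
have [ab|ba] := leP `|L (phi a)| `|L (phi b)|.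
  exists b; first by rewrite /= inE bs orbT.
  by move=> d /=; rewrite inE => /orP[/eqP -> //|/bmax].
exists a; first by rewrite /= mem_head.
move=> d /=; rewrite inE => /orP[/eqP -> //|/bmax /le_trans]; apply.
exact: ltW.
Qed.

(** All later facts on [opnorm] go through this lemma: the supremum is a
    maximum, so it is finite and bounds every value. *)
Lemma opnorm_at_vertex {Y : normedModType R} (L : {linear X -> Y}) :
  exists a, [/\ A a, opnorm L = `|L (phi a)| &
    forall x, `|L x| <= opnorm L * `|x|].
Proof.
have [a Aa amax] := norm_attained_at_vertex L; exists a.
suff eqL : opnorm L = `|L (phi a)| by split => // x; rewrite eqL.
have ub : ubound [set `|L x| | x in closed_unit_ball X] `|L (phi a)|.
  move=> _ [x x1 <-]; apply: (le_trans (amax x)).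
  by rewrite ler_piMr.
apply/eqP; rewrite eq_le; apply/andP; split.
  apply: ge_sup => //; exists `|L (phi a)|, (phi a) => //.
  exact: vertex_norm_le1.
apply: ub_le_sup; first by exists `|L (phi a)|.
by exists (phi a) => //; exact: vertex_norm_le1.
Qed.

Lemma le_opnorm {Y : normedModType R} (L : {linear X -> Y}) (x : X) :
  `|L x| <= opnorm L * `|x|.
Proof. by have [a []] := opnorm_at_vertex L. Qed.

Lemma opnorm_eq1 {Y : normedModType R} (L : {linear X -> Y}) (x : X) :
  (forall y, `|L y| <= `|y|) -> `|x| <= 1 -> 1 <= `|L x| -> opnorm L = 1.
Proof.
move=> L1 x1 Lx; have [a [Aa eqL leL]] := opnorm_at_vertex L.
apply/eqP; rewrite eq_le; apply/andP; split.
  by rewrite eqL (le_trans (L1 _))// vertex_norm_le1.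
by rewrite (le_trans Lx)// (le_trans (leL x))// ler_piMr// eqL.
Qed.

Lemma linear_bounded {Y : normedModType R} (L : {linear X -> Y}) :
  bounded_operators X Y L.
Proof.
apply/linear_boundedP; near=> r => x.
by apply: (le_trans (le_opnorm L x)); rewrite ler_wpM2r.
Unshelve. all: by end_near. Qed.

(** At a vertex [a] where [T] attains its norm, |T a|^4 = 1 already contributes
    the summand 1, and a functional supporting the ball at [a] with a large
    value at the unit vector [T a] contributes c^2. *)
Lemma dw_index_ge (c : R) : 0 <= c ->
  (forall a, A a -> forall y : X, `|y| = 1 ->
     exists f : {linear X -> R^o},
       [/\ forall x, `|f x| <= `|x|, f (phi a) = 1 & c <= `|f y|]) ->
  operator_sphere X !=set0 -> Num.sqrt (c ^+ 2 + 1) <= dw_index X.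
Proof.
move=> c0 supp [T0 ST0]; apply: lb_le_inf; first by exists (dw_radius T0), T0.
move=> _ [T [_ T1] <-].
have [a [Aa Ta leT]] := opnorm_at_vertex T; rewrite T1 in Ta.
have [f [f1 fa cf]] := supp a Aa (T (phi a)) (esym Ta).
have a1 : `|phi a| = 1.
  apply/eqP; rewrite eq_le vertex_norm_le1//=.
  by rewrite (le_trans _ (f1 _))// fa normr1.
apply: (@le_trans _ _ (Num.sqrt (`|f (T (phi a))| ^+ 2 + `|T (phi a)| ^+ 4))).
  by rewrite ler_wsqrtr// -Ta expr1n lerD2r lerXn2r// ?nnegrE.
apply: ub_le_sup; last first.
  exists (phi a, f) => //; split => //; split => //.
    exact: linear_bounded.
  apply: (opnorm_eq1 f (phi a)) => //; first by rewrite a1.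
  by rewrite fa normr1.
exists (Num.sqrt (1 + 1)) => _ [[x g] [/= x1 [_ _ g1]] <-].
have Tx : `|T x| <= 1 by rewrite (le_trans (leT x))// T1 x1 mulr1.
rewrite ler_wsqrtr// lerD// exprn_ile1//.
by rewrite (le_trans (le_opnorm g _))// g1 mul1r.
Qed.

(** For f supporting the ball at x, f (x +- e T x) = 1 +- e f (T x) is at most
    the norm of x +- e T x; so both bounds together force |f (T x)| <= c. *)
Lemma dw_index_le (c e : R) (T : {linear X -> X}) : 0 <= c -> 0 < e ->
  operator_sphere X T ->
  (forall x, `|x + e *: T x| <= (1 + e * c) * `|x|) ->
  (forall x, `|x - e *: T x| <= (1 + e * c) * `|x|) ->
  dw_index X <= Num.sqrt (c ^+ 2 + 1).
Proof.
move=> c0 e0 ST Tp Tm.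
have T1 : opnorm T = 1 by case: ST.
apply: (@le_trans _ _ (dw_radius T)).
  apply: ge_inf; last by exists T.
  exists 0 => _ [S _ <-]; apply: sup_ge0 => _ [p _ <-].
  exact: sqrtr_ge0.
have [ne|/nonemptyPn e0'] := pselect (state_pairs X !=set0); last first.
  by rewrite /dw_radius e0' image_set0 sup0 sqrtr_ge0.
apply: ge_sup; first by apply: image_nonempty.
move=> _ [[x f] [/= x1 [_ fx f1]] <-].
have lef y : `|f y| <= `|y| by rewrite (le_trans (le_opnorm f y))// f1 mul1r.
have Tx : `|T x| <= 1 by rewrite (le_trans (le_opnorm T x))// T1 x1 mulr1.
rewrite ler_wsqrtr// lerD ?exprn_ile1// lerXn2r ?nnegrE//.
have := le_trans (lef _) (Tp x); rewrite linearD linearZ /= fx x1 mulr1.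
have := le_trans (lef _) (Tm x); rewrite linearB linearZ /= fx x1 mulr1.
rewrite !ler_norml -/(_ *: _); move=> /andP[_ h1] /andP[_ h2].
have h1' : 1 - e * f (T x) <= 1 + e * c by [].
have h2' : 1 + e * f (T x) <= 1 + e * c by [].
by apply/andP; split; nra.
Qed.

End FiniteVertexSet.

(** * Vectors and functionals of three-space *)

Section Vec3.
Context {R : realType}.
Implicit Types (x y z a b : R).

Lemma vec3_eta (v : 'rV[R]_3) : v = vec3 (v 0 0) (v 0 1) (v 0 2).
Proof.
apply/rowP => -[[|[|[|//]]] k]; rewrite mxE /=;
  by congr (v _ _); apply: val_inj.
Qed.

Lemma vec3D x y z x' y' z' :
  vec3 x y z + vec3 x' y' z' = vec3 (x + x') (y + y') (z + z').
Proof. by apply/rowP => -[[|[|[|//]]] k]; rewrite !mxE. Qed.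

Lemma vec3Z a x y z : a *: vec3 x y z = vec3 (a * x) (a * y) (a * z).
Proof. by apply/rowP => -[[|[|[|//]]] k]; rewrite !mxE. Qed.

Lemma vec3N x y z : - vec3 x y z = vec3 (- x) (- y) (- z).
Proof. by apply/rowP => -[[|[|[|//]]] k]; rewrite !mxE. Qed.

(** Landing in [R^o] gives the codomain of the functionals in [dual]. *)
Definition form3 (p : R * R * R) (v : 'rV[R]_3) : R^o :=
  p.1.1 * v 0 0 + p.1.2 * v 0 1 + p.2 * v 0 2.

Lemma form3_linear p : linear (form3 p).
Proof. by move=> a u v; rewrite /form3 !mxE /GRing.scale /=; ring. Qed.

HB.instance Definition _ p :=
  GRing.isLinear.Build R 'rV[R]_3 R^o _ (form3 p) (form3_linear p).

Lemma form3E p x y z : form3 p (vec3 x y z) = p.1.1 * x + p.1.2 * y + p.2 * z.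
Proof. by rewrite /form3 !mxE. Qed.

Definition quarter_turn (k : R) (v : 'rV[R]_3) : 'rV[R]_3 :=
  vec3 (- (k * v 0 1)) (k * v 0 0) 0.

Lemma quarter_turn_linear k : linear (quarter_turn k).
Proof.
move=> a u v; rewrite /quarter_turn vec3Z vec3D !mxE.
by congr vec3; ring.
Qed.

HB.instance Definition _ k := GRing.isLinear.Build R 'rV[R]_3 'rV[R]_3 _
  (quarter_turn k) (quarter_turn_linear k).

Lemma quarter_turnE k x y z :
  quarter_turn k (vec3 x y z) = vec3 (- (k * y)) (k * x) 0.
Proof. by rewrite /quarter_turn !mxE. Qed.

End Vec3.

Lemma linear_inverse {R : realType} {E F : lmodType R} (phi : {linear E -> F}) :
  bijective phi ->
  exists psi : {linear F -> E}, cancel phi psi /\ cancel psi phi.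
Proof.
case=> g phiK gK.
have glin : linear g by apply: can2_linear phiK gK.
pose psi : {linear F -> E} := HB.pack g (GRing.isLinear.Build _ _ _ _ g glin).
by exists psi.
Qed.

Section Trigonometry.
Context {R : realType}.
Implicit Types (x y : R) (n : nat) (m k i : int).

Lemma cos_int2piD k x : cos (k%:~R * (pi *+ 2) + x) = cos x.
Proof.
have pos (l : nat) y : cos (y + l%:R * (pi *+ 2)) = cos y.
  by rewrite mulr_natl (periodicn (@cosD2pi R)).
case: k => l; first by rewrite addrC; exact: pos.
by rewrite NegzE rmorphN /= mulNr -[LHS](pos l.+1) -pmulrn addrAC addNr add0r.
Qed.

Lemma sin_int2piD k x : sin (k%:~R * (pi *+ 2) + x) = sin x.
Proof. by rewrite -!cosBpihalf -addrA cos_int2piD. Qed.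

Lemma norm_cos_natpiD (l : nat) x : `|cos (l%:R * pi + x)| = `|cos x|.
Proof.
elim: l => [|l ih]; first by rewrite mul0r add0r.
by rewrite -natr1 mulrDl mul1r addrAC cosDpi normrN.
Qed.

Lemma le_cos x y : 0 <= x -> x <= y -> y <= pi -> cos y <= cos x.
Proof.
move=> x0 xy ypi; rewrite leNgt ltr_cos -?leNgt// in_itv/=.
  by rewrite ypi (le_trans x0).
by rewrite x0 (le_trans xy).
Qed.

(** Angles are counted in half-steps pi / (2 n), so that vertices of the 2n-gon
    have even and edge normals odd indices; the index is an integer because
    neighbours on both sides and differences of indices are needed. *)
Definition angle n m : R := m%:~R * (pi / (2 * n%:R)).

Lemma angleD n m k : angle n (m + k) = angle n m + angle n k.
Proof. by rewrite /angle intrD mulrDl. Qed.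

Lemma angleN n m : angle n (- m) = - angle n m.
Proof. by rewrite /angle intrN mulNr. Qed.

Lemma angle_nat n (l : nat) : angle n l = l%:R * angle n 1.
Proof. by rewrite /angle mul1r. Qed.

Lemma angle_self n : (0 < n)%N -> angle n n = pi / 2.
Proof.
by move=> n0; rewrite /angle -pmulrn; field; rewrite pnatr_eq0 -lt0n.
Qed.

Lemma angle_turn n m : (0 < n)%N ->
  angle n (m * (2 * n)%N%:Z) = m%:~R * pi.
Proof.
move=> n0; rewrite /angle intrM -pmulrn natrM; field.
by rewrite pnatr_eq0 -lt0n.
Qed.

(** This is why the normal of an edge of the 2n-gon is maximal on that edge: up
    to sign, an odd multiple of pi / (2 n) can be reduced to one between
    pi / (2 n) and pi - pi / (2 n), where cos is monotone. *)
Lemma norm_cos_odd_angle n i : (0 < n)%N ->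
  `|cos (angle n (2 * i + 1))| <= cos (angle n 1).
Proof.
move=> n0; have n0' : 0 < n%:R :> R by rewrite ltr0n.
have d0 : 0 <= angle n 1 by rewrite /angle mul1r divr_ge0 ?pi_ge0// mulr_ge0.
have nd : (2 * n%:R) * angle n 1 = pi by rewrite /angle; field; rewrite gt_eqF.
have pos (l : nat) : `|cos (angle n (2 * l + 1)%N)| <= cos (angle n 1).
  rewrite (divn_eq l n) mulnDr -addnA PoszD angleD.
  have -> : angle n (2 * (l %/ n * n))%N = (l %/ n)%:R * pi.
    by rewrite mulnCA PoszM angle_turn.
  rewrite norm_cos_natpiD; have := ltn_pmod l n0.
  move: (l %% n)%N => r rn; rewrite angle_nat.
  have r0 : 0 <= r%:R :> R by [].
  have rn' : r%:R + 1 <= n%:R :> R by rewrite natr1 ler_nat.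
  have cosB : cos (pi - angle n 1) = - cos (angle n 1).
    by rewrite addrC cosDpi cosN.
  by rewrite natrD natrM ler_norml -cosB; apply/andP; split; apply: le_cos; nra.
case: i => l; first exact: pos.
rewrite -cosN -angleN NegzE.
have -> : - (2 * - l.+1%:Z + 1) = (2 * l + 1)%N :> int by lia.
exact: pos.
Qed.

Lemma le_half_angle n (l : nat) : (0 < l <= n)%N ->
  0 < angle n 1 <= pi / (2 * l%:R).
Proof.
move=> /andP[l0 ln]; have n0 : (0 < n)%N by exact: leq_trans ln.
rewrite /angle mul1r divr_gt0 ?pi_gt0//= ?mulr_gt0 ?ltr0n//.
rewrite ler_wpM2l ?pi_ge0// lef_pV2 ?posrE ?mulr_gt0 ?ltr0n//.
by rewrite ler_wpM2l// ler_nat.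
Qed.

Lemma half_angle_bounds n : (2 < n)%N ->
  [/\ 0 < angle n 1, 0 < cos (angle n 1) & 0 < sin (angle n 1)].
Proof.
move=> n3; have /andP[d0 d6] := @le_half_angle n 3 n3.
have p0 := pi_gt0 R.
split => //; first by apply: cos_gt0_pihalf; apply/andP; split; lra.
by apply: sin_gt0_pihalf; apply/andP; split; lra.
Qed.

(** The triple angle formula at pi / 3 factors as (c + 1) (2 c - 1)^2 = 0. *)
Lemma cos_pi3 : cos (pi / 3) = 2^-1 :> R.
Proof.
have := cospi R; have {1}-> : pi = pi / 3 *+ 2 + pi / 3 :> R by field.
rewrite cosD sin_mulr2n cos_mulr2n => e.
have c0 : 0 < cos (pi / 3) :> R.
  by apply: cos_gt0_pihalf; have := pi_gt0 R; lra.
have s2 := cos2Dsin2 (pi / 3 : R).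
set c := cos _ in e c0 s2 *; set s := sin _ in e s2 *.
have : (c + 1) * (2 * c - 1) ^+ 2 = 0.
  transitivity (((c ^+ 2 *+ 2 - 1) * c - (c * s) *+ 2 * s + 1)
                + 2 * c * (c ^+ 2 + s ^+ 2 - 1)); first by ring.
  by rewrite e s2; ring.
move/eqP; rewrite mulf_eq0 sqrf_eq0 => /orP[/eqP|/eqP]; first lra.
by lra.
Qed.

(** The inverse of the gauge of the 2n-gon at a unit vector orthogonal to a
    vertex; its direction is a vertex for even n and an edge midpoint for odd
    n. *)
Definition shrink n : R := if odd n then cos (angle n 1) else 1.
(** The smallest value that the larger of the two edge functionals at a vertex
    takes, in absolute value, on the boundary of the 2n-gon. *)
Definition gap n : R := shrink n * tan (angle n 1).

Lemma gapE n : (2 < n)%N ->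
  gap n = if odd n then sin (angle n 1) else tan (angle n 1).
Proof.
move=> /half_angle_bounds[_ c0 _]; rewrite /gap /shrink.
by case: ifP => _; rewrite ?mul1r// /tan mulrC divfK// gt_eqF.
Qed.

Lemma shrink_bounds n : (2 < n)%N -> 0 < shrink n <= 1.
Proof.
move=> /half_angle_bounds[_ c0 _]; rewrite /shrink.
by case: ifP; rewrite ?ltr01 ?lexx// c0 cos_le1.
Qed.

(** The extreme cases are n = 3, with sin (pi / 6) = 1 / 2, and n = 4, with
    tan (pi / 8) < 1 / 2; both are compared through the doubled angle. *)
Lemma gap_bounds n : (2 < n)%N -> 0 < gap n <= 2^-1.
Proof.
move=> n3; have [d0 c0 s0] := half_angle_bounds _ n3.
have p0 := pi_gt0 R.
have s2 := sin2cos2 (angle n 1).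
have e2 := cos_mulr2n (angle n 1).
rewrite gapE//; have [_|n2] := boolP (odd n).
  have /andP[_ d6] := @le_half_angle n 3 n3.
  have : cos (pi / 3) <= cos (angle n 1 *+ 2) by apply: le_cos; lra.
  rewrite cos_pi3 e2 s0 /= => h.
  by rewrite -ler_sqr ?nnegrE ?(ltW s0)// s2; lra.
have /andP[_ d8] : 0 < angle n 1 <= pi / (2 * 4%:R) by apply: le_half_angle; lia.
have c40 : 0 < cos (pi / 4) :> R by apply: cos_gt0_pihalf; lra.
have c42 : cos (pi / 4) ^+ 2 = 2^-1 :> R.
  have := cos_mulr2n (pi / 4 : R).
  have -> : pi / 4 *+ 2 = pi / 2 :> R by rewrite -mulr_natl; field.
  by rewrite cos_pihalf; lra.
have c4 : 3 / 5 <= cos (pi / 4) :> R.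
  by rewrite -ler_sqr ?nnegrE ?(ltW c40) ?divr_ge0// c42; lra.
have : cos (pi / 4) <= cos (angle n 1 *+ 2) by apply: le_cos; lra.
rewrite e2 divr_gt0//= /tan ler_pdivrMr// => h.
by rewrite -ler_sqr ?nnegrE ?mulr_ge0 ?(ltW s0) ?(ltW c0)// s2 exprMn; lra.
Qed.
End Trigonometry.

(** * Vertices and facets of the capped prism *)

Section PrismVertices.
Context {R : realType}.
Implicit Types (x y z s r : R) (n : nat) (i k : int).

Definition prism_vertex n i z : 'rV[R]_3 :=
  vec3 (cos (angle n (2 * i))) (sin (angle n (2 * i))) z.

Lemma prism_vertex_mod n i z : (0 < n)%N ->
  exists r : 'I_(2 * n), prism_vertex n i z = prism_vertex n r%:Z z.
Proof.
move=> n0; rewrite /prism_vertex (divz_eq i (2 * n)%N) mulrDr angleD.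
have turn q : angle n (2 * (q * (2 * n)%N%:Z)) = q%:~R * (pi *+ 2) :> R.
  by rewrite mulrA angle_turn// intrM; ring.
rewrite turn cos_int2piD sin_int2piD.
have : (0 <= i %% (2 * n)%N)%Z by rewrite modz_ge0//; lia.
have : (i %% (2 * n)%N < (2 * n)%N)%Z by rewrite ltz_pmod//; lia.
by case: (i %% _)%Z => // r r2n _; exists (Ordinal r2n).
Qed.

Lemma prism_vertex_in n i z : (0 < n)%N -> z = 1 \/ z = -1 ->
  capped_prism_vertices n (prism_vertex n i z).
Proof.
move=> n0 z1; left; have [r ->] := prism_vertex_mod n i z n0.
exists r.+1 => /=; first by rewrite ltn_ord.
exists z; first by case: z1 => ->; [left|right].
suff -> : (r.+1%:R - 1) * pi / n%:R = angle n (2 * r%:Z) :> R by [].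
rewrite /angle intrM -pmulrn -natr1; field.
by rewrite pnatr_eq0 -lt0n.
Qed.

Lemma capped_prism_verticesP n v : (0 < n)%N -> capped_prism_vertices n v ->
  (exists i z, (z = 1 \/ z = -1) /\ v = prism_vertex n i z) \/
  (v = vec3 0 0 2 \/ v = - vec3 0 0 2).
Proof.
move=> n0 [[j /= /andP[j1 j2] [z z1 <-]]|]; last first.
  by case=> ->; right; [left|right; rewrite vec3N oppr0].
left; exists (j%:Z - 1), z; split; first by case: z1 => ->; [left|right].
suff -> : (j%:R - 1) * pi / n%:R = angle n (2 * (j%:Z - 1)) :> R by [].
rewrite /angle intrM intrB -pmulrn; field.
by rewrite pnatr_eq0 -lt0n.
Qed.

Lemma prism_vertexN n i z : (0 < n)%N ->
  - prism_vertex n i z = prism_vertex n (i + n) (- z).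
Proof.
move=> n0; rewrite /prism_vertex vec3N mulrDr angleD.
have -> : 2 * n%:Z = 1 * (2 * n)%N%:Z by rewrite mul1r PoszM.
by rewrite angle_turn// mul1r cosDpi sinDpi.
Qed.

Lemma finite_capped_prism_vertices n : finite_set (@capped_prism_vertices R n).
Proof.
rewrite finite_setU; split => //; apply: finite_image2 => //.
by apply: (@sub_finite_set _ _ `I_(2 * n).+1) => // j /= /andP[].
Qed.

(** The segment in the dual ball from the lateral facet over edge [k] (s = 0) to
    the facet of the upper cap over the same edge (s = 1 / 2). *)
Definition face_form n k s : R * R * R :=
  ((1 - s) * cos (angle n (2 * k + 1)) / cos (angle n 1),
   (1 - s) * sin (angle n (2 * k + 1)) / cos (angle n 1), s).

Lemma face_form_prism_vertex n k s i z :
  form3 (face_form n k s) (prism_vertex n i z) =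
  (1 - s) * (cos (angle n (2 * (k - i) + 1)) / cos (angle n 1)) + s * z.
Proof.
rewrite form3E /=.
have -> : angle n (2 * (k - i) + 1) =
    angle n (2 * k + 1) - angle n (2 * i) :> R.
  by rewrite -angleN -angleD; congr (angle _ _); ring.
by rewrite cosB; ring.
Qed.

Lemma face_form_le1 n k s v : (2 < n)%N -> 0 <= s <= 2^-1 ->
  capped_prism_vertices n v -> `|form3 (face_form n k s) v| <= 1.
Proof.
move=> n3 /andP[s0 s2]; have n0 : (0 < n)%N by lia.
have [_ c0 _] := @half_angle_bounds R n n3.
case/capped_prism_verticesP => //; last first.
  suff : `|form3 (face_form n k s) (vec3 0 0 2)| <= 1.
    by move=> ? [] ->//; rewrite linearN normrN.
  by rewrite form3E /= !mulr0 !add0r ger0_norm; lra.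
case=> i [z [z1 ->]]; rewrite face_form_prism_vertex.
have : `|cos (angle n (2 * (k - i) + 1)) / cos (angle n 1)| <= 1 :> R.
  by rewrite normf_div (gtr0_norm c0) ler_pdivrMr// mul1r norm_cos_odd_angle.
set w := cos _ / _; rewrite !ler_norml => /andP[w1 w2].
by apply/andP; case: z1 => ->; split; nra.
Qed.

End PrismVertices.

Section PrismNorm.
Context {R : realType} {n : nat} {X : normedModType R}.
Hypothesis n3 : (2 < n)%N.
Context {phi : {linear 'rV[R]_3 -> X}}.
Hypothesis ballX :
  closed_unit_ball X = phi @` convex_hull (capped_prism_vertices n).

Let n0 : (0 < n)%N. Proof. by lia. Qed.

Lemma prism_vertex_norm i z : z = 1 \/ z = -1 ->
  `|phi (prism_vertex n i z)| <= 1.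
Proof. by move=> z1; apply: (vertex_norm_le1 ballX); exact: prism_vertex_in. Qed.

Lemma axis_norm z : `|phi (vec3 0 0 z)| <= `|z| / 2.
Proof.
have -> : vec3 0 0 z = (z / 2) *: vec3 0 0 2 by rewrite vec3Z !mulr0 divfK.
rewrite linearZ normrZ normrM [`|2^-1|]ger0_norm// ler_piMr//.
by apply: (vertex_norm_le1 ballX); right; left.
Qed.

Lemma combination_norm_le p q u v : 0 <= p -> 0 <= q ->
  `|phi u| <= 1 -> `|phi v| <= 1 -> `|phi (p *: u + q *: v)| <= p + q.
Proof.
move=> p0 q0 u1 v1; rewrite linearD !linearZ (le_trans (ler_normD _ _))//.
by rewrite !normrZ (ger0_norm p0) (ger0_norm q0) lerD// ler_piMr.
Qed.

Lemma midpoint_norm_le1 u v : `|phi u| <= 1 -> `|phi v| <= 1 ->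
  `|phi (2^-1 *: u + 2^-1 *: v)| <= 1.
Proof.
move=> u1 v1; have e : 2^-1 + 2^-1 = 1 :> R by field.
rewrite -[X in _ <= X]e.
by apply: combination_norm_le; rewrite ?invr_ge0.
Qed.

(** For odd n the point is the midpoint of two neighbouring vertices, half a
    step away on either side of the right angle. *)
Lemma quarter_turn_norm_prism i z : z = 1 \/ z = -1 ->
  `|phi (vec3 (- (shrink n * sin (angle n (2 * i))))
              (shrink n * cos (angle n (2 * i))) z)| <= 1.
Proof.
move=> z1; rewrite /shrink; have := odd_double_half n.
case: ifP => _ /= e; last first.
  have := prism_vertex_norm (i + n./2) z z1; rewrite /prism_vertex mulrDr angleD.
  have -> : 2 * n./2%:Z = n by lia.
  by rewrite angle_self// cosDpihalf sinDpihalf !mul1r.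
have := prism_vertex_norm (i + n./2) z z1.
have := prism_vertex_norm (i + n./2 + 1) z z1.
rewrite /prism_vertex !mulrDr !angleD.
have -> : 2 * n./2%:Z = n%:Z - 1 by lia.
have -> : 2 * 1 = 1 + 1 :> int by [].
rewrite !angleD angleN angle_self// !addrA subrK.
set a := angle n (2 * i); set d := angle n 1 => h1 h2.
have e2 : vec3 (- (cos d * sin a)) (cos d * cos a) z =
    2^-1 *: vec3 (cos (a + pi / 2 + d)) (sin (a + pi / 2 + d)) z +
    2^-1 *: vec3 (cos (a + pi / 2 - d)) (sin (a + pi / 2 - d)) z.
  rewrite !vec3Z vec3D -[cos a]sinDpihalf -[- _]mulrN -[- sin a]cosDpihalf.
  rewrite cosB sinB; move: (a + _) => b; rewrite cosD sinD.
  by congr vec3; field.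
by rewrite e2; exact: midpoint_norm_le1.
Qed.

End PrismNorm.

(** * Supporting functionals at the vertices *)

Section Frame.
Context {R : realType}.
Implicit Types (a b z s : R) (n : nat) (i k : int).

(** Cylindrical coordinates adapted to vertex [i]: [a] is radial, [b]
    tangential. *)
Definition frame_vec n i a b z : 'rV[R]_3 :=
  vec3 (a * cos (angle n (2 * i)) - b * sin (angle n (2 * i)))
       (a * sin (angle n (2 * i)) + b * cos (angle n (2 * i))) z.

Lemma frame_vec_eta n i (v : 'rV[R]_3) : exists a b,
  v = frame_vec n i a b (v 0 2).
Proof.
set c : R := cos (angle n (2 * i)); set d : R := sin (angle n (2 * i)).
exists (v 0 0 * c + v 0 1 * d), (v 0 1 * c - v 0 0 * d).
have cd : c ^+ 2 + d ^+ 2 = 1 := cos2Dsin2 _.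
rewrite [LHS]vec3_eta /frame_vec -/c -/d; congr vec3.
  by rewrite -[LHS]mulr1 -cd; ring.
by rewrite -[LHS]mulr1 -cd; ring.
Qed.

Lemma prism_vertex_frame n i z : prism_vertex n i z = frame_vec n i 1 0 z.
Proof. by rewrite /frame_vec !mul0r !mul1r subr0 addr0. Qed.

Lemma quarter_turn_prism_vertex n i z h :
  quarter_turn h (prism_vertex n i z) = frame_vec n i 0 h 0.
Proof. by rewrite quarter_turnE /frame_vec !mul0r !add0r. Qed.

Lemma prism_vertex_next n i z : prism_vertex n (i + 1) z =
  frame_vec n i (cos (angle n 1 *+ 2)) (sin (angle n 1 *+ 2)) z.
Proof.
rewrite /prism_vertex /frame_vec mulrDr mulr1 angleD.
have -> : angle n 2 = angle n 1 *+ 2 :> R by rewrite [RHS]mulr2n -angleD.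
by rewrite cosD sinD; congr vec3; ring.
Qed.

Lemma prism_vertex_prev n i z : prism_vertex n (i - 1) z =
  frame_vec n i (cos (angle n 1 *+ 2)) (- sin (angle n 1 *+ 2)) z.
Proof.
rewrite /prism_vertex /frame_vec mulrDr mulrN1 angleD angleN.
have -> : angle n 2 = angle n 1 *+ 2 :> R by rewrite [RHS]mulr2n -angleD.
by rewrite cosB sinB; congr vec3; ring.
Qed.

Lemma frame_vecD n i a b z a' b' z' :
  frame_vec n i a b z + frame_vec n i a' b' z' =
  frame_vec n i (a + a') (b + b') (z + z').
Proof. by rewrite vec3D; congr vec3; ring. Qed.

Lemma frame_vecZ n i a b z h :
  h *: frame_vec n i a b z = frame_vec n i (h * a) (h * b) (h * z).
Proof. by rewrite vec3Z; congr vec3; ring. Qed.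

Lemma axis_frame n i z : vec3 0 0 z = frame_vec n i 0 0 z.
Proof. by rewrite /frame_vec !mul0r subr0 addr0. Qed.

Lemma face_form_frame n i a b z s : (2 < n)%N ->
  form3 (face_form n i s) (frame_vec n i a b z) =
  (1 - s) * (a + b * tan (angle n 1)) + s * z.
Proof.
move=> n3; have [_ c0 _] := @half_angle_bounds R n n3.
rewrite form3E /= angleD cosD sinD /tan.
have := cos2Dsin2 (angle n (2 * i) : R).
set c : R := cos (angle n (2 * i)); set d : R := sin (angle n (2 * i)) => cd.
set u := cos _ in c0 *; set v := sin _.
transitivity ((1 - s) * (a + b * (v / u)) * (c ^+ 2 + d ^+ 2) + s * z).
  by field; rewrite gt_eqF.
by rewrite cd mulr1.
Qed.

Lemma face_form_frame_prev n i a b z s : (2 < n)%N ->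
  form3 (face_form n (i - 1) s) (frame_vec n i a b z) =
  (1 - s) * (a - b * tan (angle n 1)) + s * z.
Proof.
move=> n3; have [_ c0 _] := @half_angle_bounds R n n3.
have e : 2 * (i - 1) + 1 = 2 * i - 1 by ring.
rewrite form3E /= e angleD angleN cosB sinB /tan.
have := cos2Dsin2 (angle n (2 * i) : R).
set c : R := cos (angle n (2 * i)); set d : R := sin (angle n (2 * i)) => cd.
set u := cos _ in c0 *; set v := sin _.
transitivity ((1 - s) * (a - b * (v / u)) * (c ^+ 2 + d ^+ 2) + s * z).
  by field; rewrite gt_eqF.
by rewrite cd mulr1.
Qed.

(** The antipode of a cap facet over edge [k] is in the lower cap; the upper cap
    facet over the opposite edge differs from it by the sign of the height. *)
Lemma face_form_antipode n k s (v : 'rV[R]_3) : (0 < n)%N ->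
  form3 (face_form n (k + n) s) v =
  - form3 (face_form n k s) v + 2 * s * v 0 2.
Proof.
move=> n0; rewrite /form3 /=.
have -> : angle n (2 * (k + n%:Z) + 1) = angle n (2 * k + 1) + pi :> R.
  have -> : 2 * (k + n%:Z) + 1 = (2 * k + 1) + 1 * (2 * n)%N%:Z.
    by rewrite mul1r PoszM; ring.
  by rewrite angleD angle_turn// mul1r.
by rewrite cosDpi sinDpi; ring.
Qed.

End Frame.

(** The coefficients of the decomposition of b e + u2 e3 along the two points
    k e +- e3. *)
Lemma norm_half_sum_diff {R : realType} (u w : R) : `|u| <= `|w| ->
  `|(w + u) / 2| + `|(w - u) / 2| <= `|w|.
Proof.
wlog w0 : u w / 0 <= w => [h|].
  have [w0|w0] := lerP 0 w; first exact: h.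
  move=> uw; have := h (- u) (- w); rewrite !normrN oppr_ge0.
  rewrite -!opprD !mulNr !normrN.
  by apply => //; exact: ltW.
rewrite [X in _ <= X](ger0_norm w0) ler_norml => /andP[? ?].
by rewrite !ger0_norm ?divr_ge0//; lra.
Qed.

Section PrismOperators.
Context {R : realType} {n : nat} {X : normedModType R}.
Hypothesis n3 : (2 < n)%N.
Context {phi : {linear 'rV[R]_3 -> X}}.
Hypothesis ballX :
  closed_unit_ball X = phi @` convex_hull (capped_prism_vertices n).

Let n0 : (0 < n)%N. Proof. by lia. Qed.
Let t : R := tan (angle n 1).

Lemma quarter_norm i z : z = 1 \/ z = -1 ->
  `|phi (frame_vec n i 0 (shrink n) z)| <= 1.
Proof.
by move=> z1; rewrite /frame_vec !mul0r !add0r (quarter_turn_norm_prism n3 ballX).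
Qed.

Lemma quarter_norm0 i : `|phi (frame_vec n i 0 (shrink n) 0)| <= 1.
Proof.
have := midpoint_norm_le1 _ _ (quarter_norm i 1 (or_introl erefl))
  (quarter_norm i (-1) (or_intror erefl)).
rewrite !frame_vecZ frame_vecD.
suff -> : frame_vec n i (2^-1 * 0 + 2^-1 * 0)
  (2^-1 * shrink n + 2^-1 * shrink n)
  (2^-1 * 1 + 2^-1 * -1) = frame_vec n i 0 (shrink n) 0 :> 'rV[R]_3 by [].
by congr (frame_vec _ _ _ _ _); field.
Qed.

Lemma prism_vertex_norm0 i : `|phi (prism_vertex n i 0)| <= 1.
Proof.
have := midpoint_norm_le1 _ _ (prism_vertex_norm n3 ballX i 1 (or_introl erefl))
  (prism_vertex_norm n3 ballX i (-1) (or_intror erefl)).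
rewrite !vec3Z vec3D.
rewrite -!mulrDl mulrN subrr.
have -> : 2^-1 + 2^-1 = 1 :> R by field.
by rewrite !mul1r.
Qed.

(** The vector is a (w_i, -1) + (0, 0, u1) plus a combination of the two points
    (k e_i, +- 1); the freedom in splitting a + z = u1 + u2 lets the cheap last
    part absorb as much height as the tangential coordinate allows. *)
Lemma frame_norm i a b z u1 u2 : a + z = u1 + u2 -> `|u2| <= `|b| / shrink n ->
  `|phi (frame_vec n i a b z)| <= `|a| + `|u1| / 2 + `|b| / shrink n.
Proof.
have /andP[k0 _] := @shrink_bounds R n n3.
set r := b / shrink n; have -> : `|b| / shrink n = `|r|.
  by rewrite normf_div (gtr0_norm k0).
move=> azu u2r.
have -> : frame_vec n i a b z = a *: prism_vertex n i (-1) + vec3 0 0 u1 +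
    (((r + u2) / 2) *: frame_vec n i 0 (shrink n) 1 +
     ((r - u2) / 2) *: frame_vec n i 0 (shrink n) (-1)).
  rewrite prism_vertex_frame (axis_frame n i) !frame_vecZ !frame_vecD.
  have -> : z = u1 + u2 - a by rewrite -azu addrAC subrr add0r.
  by congr (frame_vec _ _ _ _ _); rewrite /r; field; rewrite gt_eqF.
have V := prism_vertex_norm n3 ballX i (-1) (or_intror erefl).
have Q1 := quarter_norm i 1 (or_introl erefl).
have Q2 := quarter_norm i (-1) (or_intror erefl).
rewrite !linearD (le_trans (ler_normD _ _))// lerD//.
  rewrite (le_trans (ler_normD _ _))// lerD ?(axis_norm ballX)//.
  by rewrite linearZ normrZ ler_piMr.
rewrite (le_trans (ler_normD _ _))// (le_trans _ (norm_half_sum_diff _ _ u2r))//.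
by rewrite !linearZ !normrZ lerD// ler_piMr.
Qed.

(** With r = |b| / k, the four functionals being smaller than the gap c means
    |a| < c (1 - r) and |a + z| < c (2 - r); cutting a + z at height
    2 c (1 - r) then gives norm less than 2 c (1 - r) + r <= 1. *)
Lemma prism_gap i (y : 'rV[R]_3) : `|phi y| = 1 -> exists k s,
  [/\ 0 <= s <= 2^-1, form3 (face_form n k s) (prism_vertex n i 1) = 1 &
      gap n <= `|form3 (face_form n k s) y| ].
Proof.
move=> y1; have /andP[c0 c2] := @gap_bounds R n n3.
have [_ C0 S0] := @half_angle_bounds R n n3.
have /andP[k0 k1] := @shrink_bounds R n n3.
have t0 : 0 < t by rewrite /t divr_gt0.
have v1 (s : R) : form3 (face_form n i s) (prism_vertex n i 1) = 1.
  by rewrite prism_vertex_frame face_form_frame// mul0r addr0; ring.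
have v2 (s : R) : form3 (face_form n (i - 1) s) (prism_vertex n i 1) = 1.
  by rewrite prism_vertex_frame face_form_frame_prev// mul0r subr0; ring.
apply: contrapT => no.
have lt k (s : R) : 0 <= s <= 2^-1 ->
    form3 (face_form n k s) (prism_vertex n i 1) = 1 ->
    `|form3 (face_form n k s) y| < gap n.
  by move=> s2 e; rewrite ltNge; apply/negP => le; apply: no; exists k, s.
have s0 : 0 <= (0 : R) <= 2^-1 by lra.
have s2 : 0 <= (2^-1 : R) <= 2^-1 by lra.
have [a [b ey]] := frame_vec_eta n i y.
move: (lt i 0 s0 (v1 0)) (lt i 2^-1 s2 (v1 _)).
move: (lt (i - 1) 0 s0 (v2 0)) (lt (i - 1) 2^-1 s2 (v2 _)).
rewrite ey !face_form_frame ?face_form_frame_prev// -/t.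
move: (y 0 2) ey => z ey.
set r := `|b| / shrink n.
have r0 : 0 <= r by rewrite divr_ge0// ltW.
have tb : `|b| * t = gap n * r.
  by rewrite /r /gap -/t; field; rewrite gt_eqF.
rewrite !ltr_norml => /andP[h1 h2] /andP[h3 h4] /andP[h5 h6] /andP[h7 h8].
have [ha ha'] : a + `|b| * t < gap n /\ - a + `|b| * t < gap n.
  by have [b0|b0] := ger0P b; split; lra.
have [hu hu'] : a + z + `|b| * t < 2 * gap n /\
    - (a + z) + `|b| * t < 2 * gap n.
  by have [b0|b0] := ger0P b; split; lra.
have r1 : r < 1 by rewrite -(ltr_pM2l c0) mulr1; lra.
have small u1 u2 : a + z = u1 + u2 -> `|u1| <= 2 * (gap n - gap n * r) ->
    `|u2| <= gap n * r -> False.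
  move=> azu hu1 hu2.
  have := frame_norm i a b z u1 u2 azu; rewrite -ey y1 -/r.
  have u2r : `|u2| <= r by rewrite (le_trans hu2)// ler_piMl//; lra.
  move/(_ u2r); have : `|a| < gap n - gap n * r by rewrite ltr_norml; lra.
  have : (gap n) * (1 - r) <= 2^-1 * (1 - r) by rewrite ler_wpM2r//; lra.
  by lra.
set m := 2 * _ in small; have em : m = 2 * (gap n - gap n * r) by [].
move: m em small => m em small.
have m0 : 0 <= m by lra.
(* Outside [- m, m] the height is cut off at the nearer end. *)
have [um|um] := lerP (a + z) m; last first.
  by apply: (small m (a + z - m));
    [ring | rewrite ger0_norm// | rewrite ger0_norm]; lra.
have [mu|mu] := lerP (- m) (a + z); last first.
  by apply: (small (- m) (a + z + m));
    [ring | rewrite normrN ger0_norm// | rewrite ler0_norm]; lra.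
apply: (small (a + z) 0); [by rewrite addr0 | by rewrite ler_norml mu |].
by rewrite normr0; exact: mulr_ge0 (ltW c0) r0.
Qed.

(** The condition on [b] says that the point lies in the cone over the two edges
    at vertex [i]; it is a nonnegative combination p, q of w_i and a neighbour,
    and p + q is the value of the common edge functional. *)
Lemma sector_norm i a b : 0 <= a -> `|b| <= t * a ->
  `|phi (frame_vec n i a b 0)| <= a + t * `|b|.
Proof.
move=> a0 bta; have [_ C0 S0] := @half_angle_bounds R n n3.
set C := cos (angle n 1) in C0; set S := sin (angle n 1) in S0.
have tE : t = S / C by [].
have CS : S ^+ 2 = 1 - C ^+ 2 := sin2cos2 _.
have C2E : cos (angle n 1 *+ 2) = C ^+ 2 *+ 2 - 1 := cos_mulr2n _.
have S2E : sin (angle n 1 *+ 2) = (C * S) *+ 2 := sin_mulr2n _.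
pose q := `|b| / (C * S *+ 2).
pose p := a - q * (C ^+ 2 *+ 2 - 1).
have q0 : 0 <= q by rewrite divr_ge0// mulrn_wge0// ltW// mulr_gt0.
have qt : `|b| = q * (C * S *+ 2) by rewrite /q; field; rewrite !gt_eqF.
have p0 : 0 <= p.
  have : `|b| * C <= S * a by rewrite -ler_pdivlMr// mulrAC -tE.
  rewrite qt => h.
  have : q * C ^+ 2 *+ 2 <= a.
    rewrite -(ler_pM2l S0) (le_trans _ h)// le_eqVlt.
    by apply/orP; left; apply/eqP; ring.
  by rewrite /p; lra.
have pq : p + q = a + t * `|b|.
  rewrite qt tE /p; transitivity (a + q * (2 - C ^+ 2 *+ 2)); first by ring.
  have -> : 2 - C ^+ 2 *+ 2 = S ^+ 2 *+ 2 :> R by rewrite CS; ring.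
  by field; rewrite gt_eqF.
rewrite -pq.
suff [w w1 ->] : exists2 w, `|phi w| <= 1 &
    frame_vec n i a b 0 = p *: prism_vertex n i 0 + q *: w.
  by apply: combination_norm_le => //; exact: prism_vertex_norm0.
have [b0|b0] := lerP 0 b.
  exists (prism_vertex n (i + 1) 0); first exact: prism_vertex_norm0.
  rewrite prism_vertex_frame prism_vertex_next !frame_vecZ frame_vecD.
  have -> : b = q * (C * S *+ 2) by rewrite -qt ger0_norm.
  by rewrite C2E S2E /p; congr (frame_vec _ _ _ _ _); ring.
exists (prism_vertex n (i - 1) 0); first exact: prism_vertex_norm0.
rewrite prism_vertex_frame prism_vertex_prev !frame_vecZ frame_vecD.
have -> : b = - (q * (C * S *+ 2)) by rewrite -qt ltr0_norm// opprK.
by rewrite C2E S2E /p; congr (frame_vec _ _ _ _ _); ring.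
Qed.

(** The vertex with largest inner product with [v] works: the comparison with
    its two neighbours gives both signs of the bound on [b]. *)
Lemma exists_sector (v : 'rV[R]_3) : exists i a b,
  [/\ v = frame_vec n i a b (v 0 2), 0 <= a & `|b| <= t * a].
Proof.
have [_ C0 S0] := @half_angle_bounds R n n3.
pose dot (w : 'rV[R]_3) : R := v 0 0 * w 0 0 + v 0 1 * w 0 1.
have n2 : (0 < 2 * n)%N by lia.
have [i0 _ imax] := @arg_maxP _ R 'I_(2 * n) (Ordinal n2) xpredT
  (fun r => dot (prism_vertex n r%:Z 0)) erefl.
pose i : int := i0%:Z.
have {}imax k : dot (prism_vertex n k 0) <= dot (prism_vertex n i 0).
  by have [r ->] := @prism_vertex_mod R n k 0 n0; exact: imax.
have [a [b ev]] := frame_vec_eta n i v.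
have dotE a' b' : dot (frame_vec n i a' b' 0) = a * a' + b * b'.
  rewrite /dot ev /frame_vec !mxE /=.
  have := cos2Dsin2 (angle n (2 * i) : R).
  set c : R := cos _; set d : R := sin _ => cd.
  by rewrite -[RHS]mulr1 -cd; ring.
have := imax (i + 1); have := imax (i - 1).
rewrite prism_vertex_prev prism_vertex_next prism_vertex_frame !dotE.
rewrite mulr1 mulr0 addr0 cos_mulr2n sin_mulr2n.
have := sin2cos2 (angle n 1 : R).
rewrite /t /tan; move: (cos _) (sin _) C0 S0 => C S C0 S0 CS hm hp.
have {}hm : - b * C <= S * a.
  by rewrite -(ler_pM2l S0) [S * (S * a)]mulrA -expr2 CS; lra.
have {}hp : b * C <= S * a.
  by rewrite -(ler_pM2l S0) [S * (S * a)]mulrA -expr2 CS; lra.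
have bt : `|b| <= S / C * a.
  by rewrite mulrAC ler_pdivlMr//; have [] := ger0P b.
exists i, a, b; split => //.
by rewrite -(pmulr_rge0 _ (divr_gt0 S0 C0)) (le_trans _ bt).
Qed.

(** For negative height the facet over the opposite edge is used. *)
Lemma apex_gap (y : 'rV[R]_3) : `|phi y| = 1 -> exists k,
  gap n <= `|form3 (face_form n k 2^-1) y|.
Proof.
move=> y1; have /andP[c0 c2] := @gap_bounds R n n3.
have [i [a [b [ey a0 bta]]]] := exists_sector y.
have ny : 1 <= a + t * `|b| + `|y 0 2| / 2.
  rewrite -[leLHS]y1 {1}ey.
  have -> : frame_vec n i a b (y 0 2) = frame_vec n i a b 0 + vec3 0 0 (y 0 2).
    by rewrite (axis_frame n i) frame_vecD !addr0 add0r.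
  rewrite linearD (le_trans (ler_normD _ _))// lerD ?(axis_norm ballX)//.
  exact: sector_norm.
have [k kE] : exists k,
    form3 (face_form n k 2^-1) y = 2^-1 * (a + t * `|b| + y 0 2).
  have [b0|b0] := ger0P b; [exists i | exists (i - 1)].
    by rewrite {1}ey face_form_frame// -/t; field.
  by rewrite {1}ey face_form_frame_prev// -/t; field.
have z0 := normr_ge0 (y 0 2).
have [zp|zm] := lerP 0 (y 0 2).
  exists k; rewrite kE (le_trans c2)// (le_trans _ (ler_norm _))//.
  by move: ny z0; rewrite (ger0_norm zp); lra.
exists (k + n); rewrite face_form_antipode// kE -normrN.
rewrite (le_trans c2)// (le_trans _ (ler_norm _))//.
by move: ny z0; rewrite (ltr0_norm zm); lra.
Qed.

End PrismOperators.

(** * The extremal operator *)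

Section PrismIndex.
Context {R : realType} {n : nat} {X : normedModType R}.
Hypothesis n3 : (2 < n)%N.
Context {phi : {linear 'rV[R]_3 -> X}} {psi : {linear X -> 'rV[R]_3}}.
Hypotheses (phiK : cancel phi psi) (psiK : cancel psi phi).
Hypothesis ballX :
  closed_unit_ball X = phi @` convex_hull (capped_prism_vertices n).

Let n0 : (0 < n)%N. Proof. by lia. Qed.

Lemma face_form_norm_le k s x : 0 <= s <= 2^-1 ->
  `|form3 (face_form n k s) (psi x)| <= `|x|.
Proof.
move=> s2; rewrite -[leRHS]mul1r.
apply: (norm_le_on_vertices ballX (form3 (face_form n k s) \o psi)) => v hv /=.
by rewrite phiK; exact: face_form_le1.
Qed.

(** Up to sign, every vertex is some (w_i, 1) or the upper apex. *)
Lemma support_functional_gap (v : 'rV[R]_3) : capped_prism_vertices n v ->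
  forall y : X, `|y| = 1 -> exists f : {linear X -> R^o},
    [/\ forall x, `|f x| <= `|x|, f (phi v) = 1 & gap n <= `|f y|].
Proof.
move=> hv y y1; pose supports u := exists k s,
  [/\ 0 <= s <= 2^-1, form3 (face_form n k s) u = 1 &
      gap n <= `|form3 (face_form n k s) (psi y)| ].
have phipsi1 : `|phi (psi y)| = 1 by rewrite psiK.
have prism i : supports (prism_vertex n i 1) by exact: (prism_gap n3 ballX).
have apex : supports (vec3 0 0 2).
  have [k hk] := apex_gap n3 ballX _ phipsi1.
  exists k, 2^-1; split => //; first by rewrite lexx invr_ge0 ler0n.
  by rewrite form3E /= !mulr0 !add0r mulVf ?pnatr_eq0.
have [u [k [s [s2 ku hk]]] vu] : exists2 u, supports u & v = u \/ v = - u.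
  case: (capped_prism_verticesP n v n0 hv) => [[i [z [z1 ->]]]|hv'].
    case: z1 => ->; first by exists (prism_vertex n i 1); [|left].
    exists (- prism_vertex n i (-1)); last by right; rewrite opprK.
    by rewrite prism_vertexN// opprK.
  by exists (vec3 0 0 2).
have le1 x : `|(form3 (face_form n k s) \o psi) x| <= `|x|.
  exact: face_form_norm_le.
case: vu => ->.
  exists (form3 (face_form n k s) \o psi); split => //=.
  by rewrite phiK.
exists (\- (form3 (face_form n k s) \o psi)); split => [x||] /=.
- by rewrite normrN; exact: le1.
- by rewrite phiK linearN /= ku opprK.
- by rewrite normrN.
Qed.

Definition quarter_operator : {linear X -> X} :=
  phi \o quarter_turn (shrink n) \o psi.

Lemma quarter_operatorE v :
  quarter_operator (phi v) = phi (quarter_turn (shrink n) v).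
Proof. by rewrite /= phiK. Qed.

Lemma quarter_operator_apex h z :
  phi (vec3 0 0 z) + h *: quarter_operator (phi (vec3 0 0 z)) =
  phi (vec3 0 0 z).
Proof.
rewrite quarter_operatorE quarter_turnE !mulr0 oppr0.
have -> : vec3 0 0 0 = 0 :> 'rV[R]_3.
  by apply/rowP => -[[|[|[|//]]] ?]; rewrite !mxE.
by rewrite linear0 scaler0 addr0.
Qed.

Lemma capped_prism_ind (P : 'rV[R]_3 -> Prop) :
  (forall i z, z = 1 \/ z = -1 -> P (prism_vertex n i z)) ->
  (forall z, `|z| = 2 -> P (vec3 0 0 z)) ->
  forall v, capped_prism_vertices n v -> P v.
Proof.
move=> Pprism Pz v /(capped_prism_verticesP _ _ n0)[[i [z [z1 ->]]]|].
  exact: Pprism.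
by case=> ->; rewrite ?vec3N ?oppr0; apply: Pz; rewrite ?normrN ger0_norm.
Qed.

Lemma quarter_operator_contraction x : `|quarter_operator x| <= `|x|.
Proof.
rewrite -[leRHS]mul1r; move: x; apply: (norm_le_on_vertices ballX).
apply: capped_prism_ind => [i z z1|z _].
  rewrite quarter_operatorE quarter_turn_prism_vertex.
  exact: (quarter_norm0 n3 ballX).
rewrite quarter_operatorE quarter_turnE !mulr0 oppr0.
by rewrite (le_trans (axis_norm ballX _))// normr0 mul0r.
Qed.

Lemma quarter_operator_sphere : operator_sphere X quarter_operator.
Proof.
have fA := @finite_capped_prism_vertices R n.
have A0 : @capped_prism_vertices R n !=set0.
  by exists (vec3 0 0 2); right; left.
split; first exact: (linear_bounded ballX).
have h01 : 1 = 1 :> R \/ 1 = -1 :> R by left.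
apply: (opnorm_eq1 ballX fA A0 _ (phi (prism_vertex n 0 1))).
- exact: quarter_operator_contraction.
- exact: (prism_vertex_norm n3 ballX).
have s0 : 0 <= (0 : R) <= 2^-1 by lra.
have [_ C0 _] := @half_angle_bounds R n n3.
(* The edge in the direction orthogonal to vertex 0 certifies norm 1. *)
apply: (le_trans _ (face_form_norm_le n./2 0 _ s0)).
rewrite quarter_operatorE phiK quarter_turn_prism_vertex.
have e : shrink n * sin (angle n (2 * n./2%:Z + 1)) = cos (angle n 1) :> R.
  rewrite /shrink; have := odd_double_half n; case: ifP => _ /= nE.
    have -> : 2 * n./2%:Z + 1 = n%:Z by lia.
    by rewrite angle_self// sin_pihalf mulr1.
  have -> : 2 * n./2%:Z + 1 = n%:Z + 1 by lia.
  by rewrite mul1r angleD angle_self// addrC sinDpihalf.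
have a0 : angle n (2 * 0) = 0 :> R by rewrite mulr0 /angle mul0r.
suff -> : form3 (face_form n n./2 0) (frame_vec n 0 0 (shrink n) 0) = 1 :> R.
  by rewrite normr1.
rewrite form3E /= a0 cos0 sin0.
transitivity (shrink n * sin (angle n (2 * n./2%:Z + 1)) / cos (angle n 1) : R).
  by ring.
by rewrite e divff ?gt_eqF.
Qed.

(** The step along [quarter_operator] that takes a vertex to a nonnegative
    combination of its horizontal part and its neighbour, the latter with
    coefficient 1. *)
Let rate : R := sin (angle n 1 *+ 2) / shrink n.

Lemma rate_gt0 : 0 < rate.
Proof.
have [_ C0 S0] := @half_angle_bounds R n n3.
have /andP[k0 _] := @shrink_bounds R n n3.
by rewrite divr_gt0// sin_mulr2n mulrn_wgt0// mulr_gt0.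
Qed.

Lemma rate_gap : rate * gap n = 1 - cos (angle n 1 *+ 2).
Proof.
have [_ C0 S0] := @half_angle_bounds R n n3.
have /andP[k0 _] := @shrink_bounds R n n3.
have s2 := sin2cos2 (angle n 1 : R).
transitivity (sin (angle n 1) ^+ 2 *+ 2 : R).
  rewrite /rate /gap /tan sin_mulr2n; field.
  by rewrite !gt_eqF.
by rewrite s2 cos_mulr2n; ring.
Qed.

Lemma quarter_operator_tilt h x : h = rate \/ h = - rate ->
  `|x + h *: quarter_operator x| <= (1 + rate * gap n) * `|x|.
Proof.
move=> hr; have /andP[k0 _] := @shrink_bounds R n n3.
have c1 : 0 <= 1 - cos (angle n 1 *+ 2) :> R by rewrite subr_ge0 cos_le1.
suff tilt v : capped_prism_vertices n v ->
    `|phi v + h *: quarter_operator (phi v)| <= 1 + rate * gap n.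
  exact: (norm_le_on_vertices ballX (idfun \+ (h \*: quarter_operator)) _ tilt).
rewrite rate_gap; move: v; apply: capped_prism_ind => [i z z1|z z2]; last first.
  rewrite quarter_operator_apex.
  by rewrite (le_trans (axis_norm ballX _))// z2 divff// lerDl.
have [w w1 wE] : exists2 w, `|phi w| <= 1 &
    prism_vertex n i z + h *: frame_vec n i 0 (shrink n) 0 =
    (1 - cos (angle n 1 *+ 2)) *: prism_vertex n i 0 + 1 *: w.
  case: hr => ->;
    [exists (prism_vertex n (i + 1) z) | exists (prism_vertex n (i - 1) z)];
    rewrite ?(prism_vertex_norm n3 ballX)//;
    rewrite ?prism_vertex_next ?prism_vertex_prev !prism_vertex_frame;
    rewrite !frame_vecZ !frame_vecD; congr (frame_vec _ _ _ _ _);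
    by rewrite /rate; field; rewrite gt_eqF.
rewrite quarter_operatorE quarter_turn_prism_vertex -linearZ -linearD wE.
rewrite [leRHS]addrC; apply: combination_norm_le => //.
exact: (prism_vertex_norm0 n3 ballX).
Qed.

End PrismIndex.

Theorem theorem3p6 (R : realType) (n : nat) (n_ge3 : (3 <= n)%N)
  (X : completeNormedModType R)
  (phi : {linear 'rV[R]_3 -> X}) (phi_bij : bijective phi)
  (ballX : closed_unit_ball X
           = phi @` convex_hull (capped_prism_vertices n)) :
  dw_index X =
    if odd n then Num.sqrt (sin (pi / (2 * n%:R)) ^+ 2 + 1)
    else Num.sqrt (tan (pi / (2 * n%:R)) ^+ 2 + 1).
Proof.
have [psi [phiK psiK]] := linear_inverse phi phi_bij.
have gE : Num.sqrt (gap n ^+ 2 + 1) =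
    if odd n then Num.sqrt (sin (pi / (2 * n%:R)) ^+ 2 + 1)
    else Num.sqrt (tan (pi / (2 * n%:R)) ^+ 2 + 1) :> R.
  by rewrite gapE// /angle mul1r; case: ifP.
have /andP[/ltW g0 _] := @gap_bounds R n n_ge3.
have fA := @finite_capped_prism_vertices R n.
have A0 : @capped_prism_vertices R n !=set0.
  by exists (vec3 0 0 2); right; left.
have ST := quarter_operator_sphere n_ge3 phiK ballX.
rewrite -gE; apply/eqP; rewrite eq_le; apply/andP; split.
  apply: (dw_index_le ballX fA A0 _ _ _ g0
    (rate_gt0 n_ge3) ST) => x.
    by apply: (quarter_operator_tilt n_ge3 phiK ballX); left.
  rewrite -scaleNr.
  by apply: (quarter_operator_tilt n_ge3 phiK ballX); right.
apply: (dw_index_ge ballX fA A0 _ g0); last by eexists; exact: ST.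
exact: (support_functional_gap n_ge3 phiK psiK ballX).
Qed.
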